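(* Let $\mathcal T_p$ be a directed tree on $p$ nodes and $\widehat{\mathcal T_p}$ the corresponding essential graph. Suppose that $\widehat{\mathcal T_p}$ has $\ell>0$ chain components $\tau_1,\ldots,\tau_\ell$ and that the directed subforest $\mathcal G(\widehat{\mathcal T_p})$ of $\widehat{\mathcal T_p}$ has $m\ge0$ connected components $\varepsilon_1,\ldots,\varepsilon_m$. Then $$2^\ell\le \#[\mathcal T_p]\le\left(\frac{p-m}{\ell}\right)^\ell.$$
   Context: A DAG is a directed acyclic graph; its skeleton is its underlying undirected graph. An immorality is an induced subgraph $i\to j\leftarrow k$ ($i,k$ nonadjacent). Two DAGs are Markov equivalent iff they have the same skeleton and the same set of immoralities. A directed tree on $p$ nodes is a DAG $\mathcal T_p$ whose skeleton is a tree with $p$ vertices; $[\mathcal T_p]$ denotes its Markov equivalence class (the set of all DAGs Markov equivalent to it), and $\#[\mathcal T_p]$ its cardinality. The essential graph $\widehat{\mathcal T_p}$ is the partially directed graph on the same skeleton in which an edge is directed iff it has the same orientation in every member of $[\mathcal T_p]$ (with that orientation), and is undirected otherwise. The chain components of $\widehat{\mathcal T_p}$ are the connected components of its undirected part; here only the nontrivial ones, i.e. those with at least two vertices, are considered and listed as $\tau_1,\ldots,\tau_\ell$. $\mathcal G(\widehat{\mathcal T_p})$ is the directed subforest of $\widehat{\mathcal T_p}$ consisting of all its directed edges (and their endpoints). *)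

(* Defs.v *)
From mathcomp Require Import all_boot all_order all_algebra.

Set Implicit Arguments.
Unset Strict Implicit.
Unset Printing Implicit Defensive.

(* A directed graph with vertex set V is its set of arcs: (x, y) \in D means
   x -> y. *)
Definition digraph (V : finType) := {set V * V}.

Definition arc (V : finType) (D : digraph V) : rel V :=
  fun x y => (x, y) \in D.

Definition adjacent (V : finType) (D : digraph V) : rel V :=
  fun x y => arc D x y || arc D y x.

(* Each undirected edge {x, y} occurs as both (x, y) and (y, x). *)
Definition skeleton (V : finType) (D : digraph V) : {set V * V} :=
  [set e | adjacent D e.1 e.2].

(* No arc x -> y can be closed up by a (possibly empty) directed path from y
   to x; in particular there are no loops and no 2-cycles. *)
Definition is_dag (V : finType) (D : digraph V) : bool :=
  [forall x, forall y, arc D x y ==> ~~ connect (arc D) y x].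

Lemma is_dagP (V : finType) (D : digraph V) :
  reflect (forall c : seq V, cycle (arc D) c -> c = [::]) (is_dag D).
Proof.
apply: (iffP idP) => [dagD [//|x c] cyc | nocyc].
  case: c cyc => [|y c] /=.
    rewrite andbT => xx; have /forallP/(_ x)/forallP/(_ x) := dagD.
    by rewrite xx connect0.
  case/andP=> xy yx; have /forallP/(_ x)/forallP/(_ y) := dagD.
  rewrite xy /=; case/negP; apply/connectP.
  by exists (rcons c x); rewrite ?last_rcons.
apply/forallP=> x; apply/forallP=> y; apply/implyP=> xy.
apply/negP=> /connectP[q yq xE].
have := nocyc (y :: q); rewrite /= rcons_path yq -xE xy => /(_ isT).
by [].
Qed.

(* Immoralities i -> j <- k, as triples (i, j, k); the mirror triple (k, j, i)
   belongs to the set as well. *)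
Definition immoralities (V : finType) (D : digraph V) : {set V * V * V} :=
  [set t : V * V * V | let: (i, j, k) := t in
     [&& i != k, arc D i j, arc D k j & ~~ adjacent D i k]].

Definition markov_equiv (V : finType) (D1 D2 : digraph V) : bool :=
  (skeleton D1 == skeleton D2) && (immoralities D1 == immoralities D2).

Definition markov_class (V : finType) (D : digraph V) : {set digraph V} :=
  [set D' : digraph V | is_dag D' && markov_equiv D D'].

(* For a symmetric irreflexive e. Cycles of size at most 2 are only the
   backtrackings along a single edge. *)
Definition is_tree (V : finType) (e : rel V) : Prop :=
  [/\ 0 < #|V|,
      forall x y : V, connect e x y
    & forall c : seq V, ucycle e c -> size c <= 2].

Definition directed_tree (V : finType) (D : digraph V) : Prop :=
  is_dag D /\ is_tree (adjacent D).

Definition essential_directed (V : finType) (D : digraph V) : digraph V :=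
  [set e in D | [forall D' in markov_class D, e \in D']].

Definition essential_undirected (V : finType) (D : digraph V) : rel V :=
  fun x y => adjacent D x y && ~~ adjacent (essential_directed D) x y.

Definition chain_components (V : finType) (D : digraph V) : {set {set V}} :=
  [set C in equivalence_partition (connect (essential_undirected D)) [set: V]
     | 2 <= #|C|].

Definition endpoints (V : finType) (D : digraph V) : {set V} :=
  [set x | [exists y, adjacent D x y]].

(* Weakly connected components of the subgraph formed by the directed edges
   of the essential graph and their endpoints. *)
Definition directed_components (V : finType) (D : digraph V) : {set {set V}} :=
  equivalence_partition (connect (adjacent (essential_directed D)))
    (endpoints (essential_directed D)).

(* Main.v *)
Require Import Defs.
From mathcomp Require Import all_boot all_order all_algebra.
Import Order.TTheory GRing.Theory Num.Theory.
(* arc is meant for digraphs here, not as path.arc. *)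
Import Defs.

(** In a tree two parents of a common child are never adjacent, so a member of
the Markov class is an orientation of the tree in which the same pairs of
distinct arcs meet head to head as in T ([in_markov_class]).

Call a vertex compelled when it is a collider of T or has one among its
ancestors. Going down from the colliders, every member of the class must
repeat T on the arcs whose head is compelled ([compelled_parents]); any other
arc lies between two uncompelled vertices, where each vertex has at most one
parent in every member. So outside the compelled vertices a member of the class
is a forest in which every component is rooted at its unique source and oriented
away from it ([free_arc_det]). A source arc r -> c whose head has no other
parent may be reversed without leaving the class ([flip_markov]), and repeating
this carries the source to any vertex of the component ([free_reroot]). Hence
the essential arcs are exactly those with a compelled head, and the
nontrivial chain components are the nontrivial components of the tree induced
on the uncompelled vertices.

Lower bound: in each chain component pick an arc of T that leaves its source;
these arcs can be reversed independently of each other. Upper bound: a member of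
the class is determined by its source in each chain component, so the class has
at most \prod #|tau_i| members, and by the inequality of arithmetic and
geometric means this is at most ((\sum #|tau_i|) / l) ^ l. The chain
components are disjoint and avoid the compelled vertices, while each directed
component contains a compelled vertex, namely the head of one of its arcs;
therefore \sum #|tau_i| + m <= p. *)

(** * Digraphs and acyclicity *)

Set Implicit Arguments.
Unset Strict Implicit.
Unset Printing Implicit Defensive.

Definition source (V : finType) (D : digraph V) (x : V) : bool :=
  [forall y, ~~ arc D y x].

Definition collider (V : finType) (D : digraph V) (y : V) : bool :=
  [exists i, exists k, [&& i != k, arc D i y & arc D k y]].

Definition compelled (V : finType) (D : digraph V) : {set V} :=
  [set y | [exists k, collider D k && connect (arc D) k y]].

Lemma sourceP (V : finType) (D : digraph V) (x : V) :
  reflect (forall y, ~~ arc D y x) (source D x).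
Proof. exact: forallP. Qed.

Arguments sourceP {V D x}.

Lemma colliderP (V : finType) (D : digraph V) (y : V) :
  reflect (exists i k, [/\ i != k, arc D i y & arc D k y]) (collider D y).
Proof.
apply: (iffP existsP) => [[i /existsP[k /and3P[? ? ?]]]|[i [k [ik iy ky]]]].
  by exists i, k.
by exists i; apply/existsP; exists k; rewrite ik iy ky.
Qed.

Lemma adjacentC (V : finType) (D : digraph V) : symmetric (adjacent D).
Proof. by move=> x y; rewrite /adjacent orbC. Qed.

Lemma dag_asym (V : finType) (D : digraph V) (x y : V) :
  is_dag D -> arc D x y -> ~~ arc D y x.
Proof.
move=> /forallP/(_ x)/forallP/(_ y)/implyP dagD /dagD.
by apply: contra => /connect1.
Qed.

Lemma adjacent_irrefl (V : finType) (D : digraph V) (x : V) :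
  is_dag D -> adjacent D x x = false.
Proof.
move=> dagD; rewrite /adjacent orbb; apply/negP => xx.
by move/negP: (dag_asym dagD xx).
Qed.

(** Induction from parents to children: in a DAG a parent has strictly fewer
ancestors than its child. *)
Lemma dag_ind (V : finType) (D : digraph V) (P : V -> Prop) :
  is_dag D -> (forall y, (forall x, arc D x y -> P x) -> P y) ->
  forall y, P y.
Proof.
move=> dagD IH y.
have [n] := ubnP #|[set x | connect (arc D) x y]|.
elim: n y => // n IHn y lt_y; apply: IH => x xy; apply: IHn.
rewrite -ltnS; apply: leq_trans lt_y; rewrite !ltnS.
apply: proper_card; apply/properP; split.
  apply/subsetP => z; rewrite !inE => /connect_trans; apply.
  exact: connect1.
exists y; rewrite inE ?connect0 //.
by move/forallP/(_ x)/forallP/(_ y)/implyP: dagD; apply.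
Qed.

(** A directed cycle longer than 2 would be a cycle of the tree, so only loops
and 2-cycles have to be excluded. *)
Lemma tree_orientation_dag (V : finType) (T D : digraph V) :
  directed_tree T -> adjacent D =2 adjacent T ->
  (forall x y, arc D x y -> ~~ arc D y x) -> is_dag D.
Proof.
move=> [dagT [_ _ treeT]] adjD asymD.
apply/forallP => x; apply/forallP => y; apply/implyP => xy.
apply/negP => /connectP[p0 p0y xE]; move: xy; rewrite {x}xE.
case/shortenP: p0y => p py uniqp _ {p0} xy.
have : size (y :: p) <= 2.
  apply: treeT; rewrite /ucycle uniqp andbT /= rcons_path.
  rewrite -adjD /adjacent xy andbT.
  apply: sub_path py => u v uv; change (adjacent T u v).
  by rewrite -adjD /adjacent uv.
case: p py {uniqp} xy => [|x [|//]] /=.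
  by move=> _ yy; move/negP: (asymD _ _ yy).
by rewrite andbT => yx /asymD; rewrite yx.
Qed.

Lemma tree_no_triangle (V : finType) (T : digraph V) (i j k : V) :
  directed_tree T -> i != k -> adjacent T i j -> adjacent T k j ->
  ~~ adjacent T i k.
Proof.
move=> [dagT [_ _ treeT]] ik ij kj; apply/negP => aik.
suff: size [:: i; j; k] <= 2 by [].
apply: treeT; rewrite /ucycle /= !inE ij adjacentC kj adjacentC aik /=.
rewrite negb_or ik !andbT.
apply/andP; split; apply/eqP => eqj.
  by move: ij; rewrite eqj adjacent_irrefl.
by move: kj; rewrite eqj adjacent_irrefl.
Qed.

(** * Members of the Markov class *)

(** Since a tree has no triangles, the nonadjacency condition in the definition
of immoralities is automatic, and acyclicity reduces to antisymmetry. *)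
Lemma in_markov_class (V : finType) (T D : digraph V) :
  directed_tree T ->
  reflect
    [/\ adjacent D =2 adjacent T, forall x y, arc D x y -> ~~ arc D y x
      & forall i j k, i != k -> arc D i j && arc D k j = arc T i j && arc T k j]
    (D \in markov_class T).
Proof.
move=> treeT; have [dagT _] := treeT.
have imm D' i j k : adjacent D' =2 adjacent T -> i != k ->
  ((i, j, k) \in immoralities D') = arc D' i j && arc D' k j.
  move=> adjD ik; rewrite inE ik /=; case ij: (arc D' i j) => //=.
  case kj: (arc D' k j) => //=; rewrite adjD.
  by apply: (tree_no_triangle (j := j) treeT ik); rewrite -adjD /adjacent
    ?ij ?kj.
rewrite inE /markov_equiv; apply: (iffP and3P) => [[dagD /eqP skD /eqP imD]|].
  have adjD : adjacent D =2 adjacent T.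
    by move=> x y; have /setP/(_ (x, y)) := skD; rewrite !inE.
  split=> // [x y|i j k ik]; first exact: dag_asym.
  by rewrite -!imm // imD.
move=> [adjD asymD parD]; split.
- exact: tree_orientation_dag adjD asymD.
- by apply/eqP/setP => -[x y]; rewrite !inE /= adjD.
apply/eqP/setP => -[[i j] k]; have [->|ik] := eqVneq i k.
  by rewrite !inE eqxx.
by rewrite !imm // parD.
Qed.

Lemma markov_class_refl (V : finType) (T : digraph V) :
  directed_tree T -> T \in markov_class T.
Proof. by move=> treeT; rewrite inE treeT.1 /markov_equiv !eqxx. Qed.

Lemma markov_class_dag (V : finType) (T D : digraph V) :
  D \in markov_class T -> is_dag D.
Proof. by rewrite inE => /andP[]. Qed.

Lemma markov_class_eq (V : finType) (T D : digraph V) :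
  D \in markov_class T -> markov_class D = markov_class T.
Proof.
rewrite inE => /and3P[_ /eqP skD /eqP imD].
by apply/setP => D'; rewrite !inE /markov_equiv skD imD.
Qed.

Lemma markov_class_tree (V : finType) (T D : digraph V) :
  directed_tree T -> D \in markov_class T -> directed_tree D.
Proof.
move=> treeT DT; have /in_markov_class[// |adjD _ _] := DT.
have [_ [V0 conT cycT]] := treeT.
split; first exact: markov_class_dag DT.
split=> // [x y|c]; first by rewrite (eq_connect adjD).
by rewrite /ucycle (eq_cycle adjD); apply: cycT.
Qed.

(** * Compelled and free vertices *)

(** Each parent of a collider is one of two distinct parents, hence takes part in
an immorality. *)
Lemma collider_parents (V : finType) (T D : digraph V) (x y : V) :
  directed_tree T -> D \in markov_class T -> collider T y ->
  arc D x y = arc T x y.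
Proof.
move=> treeT /in_markov_class[// |_ _ parD] /colliderP[i [k [ik iy ky]]].
have := parD i y k ik; rewrite iy ky => /andP[Diy Dky].
have [->|xi] := eqVneq x i; first by rewrite iy Diy.
by have := parD x y i xi; rewrite iy Diy !andbT.
Qed.

(** By induction along a directed path from a collider: if a non-collider y has a
parent z whose own incoming arcs are already forced, then z -> y cannot be
reversed, and any second parent of y would create a new immorality. *)
Lemma compelled_parents (V : finType) (T D : digraph V) (x y : V) :
  directed_tree T -> D \in markov_class T -> y \in compelled T ->
  arc D x y = arc T x y.
Proof.
move=> treeT DT; rewrite inE => /existsP[k /andP[colk /connectP[p]]].
elim/last_ind: p y x => [|p y0 IHp] y x /=.
  by move=> _ ->; apply: collider_parents.
rewrite rcons_path last_rcons => /andP[kp zy] ->{y}.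
have {kp IHp} := IHp _ _ kp erefl; move: zy; move: (last k p) => z zy parz.
have [coly|ncoly] := boolP (collider T y0); first exact: collider_parents.
have /in_markov_class[// |adjD asymD parD] := DT.
have Dzy : arc D z y0.
  have : adjacent D z y0 by rewrite adjD /adjacent zy.
  case/orP=> // ; rewrite parz => yz.
  by move/negP: (dag_asym treeT.1 zy).
have [->|xz] := eqVneq x z; first by rewrite zy.
by have := parD x y0 z xz; rewrite zy Dzy !andbT.
Qed.

Lemma compelled_arc (V : finType) (T : digraph V) (x y : V) :
  x \in compelled T -> arc T x y -> y \in compelled T.
Proof.
rewrite !inE => /existsP[k /andP[colk kx]] xy; apply/existsP; exists k.
by rewrite colk (connect_trans kx) // connect1.
Qed.

(** The tree edges between a compelled and an uncompelled vertex point towards the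
compelled one, in T and therefore in every member of the class. *)
Lemma free_parent (V : finType) (T D : digraph V) (x y : V) :
  directed_tree T -> D \in markov_class T -> y \notin compelled T ->
  arc D x y -> x \notin compelled T.
Proof.
move=> treeT DT Ay Dxy; apply/negP => Ax.
have /in_markov_class[// |adjD asymD _] := DT.
have : adjacent T x y by rewrite -adjD /adjacent Dxy.
case/orP => [xy|yx]; first by rewrite (compelled_arc Ax xy) in Ay.
move: (asymD _ _ Dxy); rewrite (compelled_parents y treeT DT Ax).
by rewrite yx.
Qed.

Lemma free_parent_uniq (V : finType) (T D : digraph V) (x y z : V) :
  directed_tree T -> D \in markov_class T -> y \notin compelled T ->
  arc D x y -> arc D z y -> x = z.
Proof.
move=> treeT DT Ay xy zy; apply/eqP/negPn/negP => xz; case/negP: Ay.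
have /in_markov_class[// |_ _ parD] := DT.
have := parD x y z xz; rewrite xy zy => /esym/andP[Txy Tzy].
rewrite inE; apply/existsP; exists y; rewrite connect0 andbT.
by apply/colliderP; exists x, z.
Qed.

(** Leaving a source, each step of the path must follow an arc: a step against an
arc would give its starting point a second parent. *)
Lemma source_path_directed (V : finType) (D : digraph V) (s : V) (p : seq V) :
  (forall y x z, y \in p -> arc D x y -> arc D z y -> x = z) ->
  source D s -> uniq (s :: p) -> path (adjacent D) s p -> path (arc D) s p.
Proof.
move=> par /sourceP srcs.
(* The induction needs only that no parent of s occurs later on the path. *)
have : forall z, arc D z s -> z \notin p by move=> z; rewrite (negPf (srcs z)).
elim: p s par {srcs} => // a p IHp s par srcs /andP[sp up] /andP[sa ap] /=.
have Dsa : arc D s a.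
  by case/orP: sa => // /srcs; rewrite inE eqxx.
rewrite Dsa; apply: IHp => // [y x z yp|z za].
  by apply: par; rewrite inE yp orbT.
rewrite (par a z s _ za Dsa) ?mem_head //.
by move: sp; rewrite inE negb_or => /andP[].
Qed.

(** For a directed tree, this is the undirected part of the essential graph; see
[essential_undirectedE]. *)
Definition free_edge (V : finType) (T : digraph V) : rel V :=
  fun x y => [&& adjacent T x y, x \notin compelled T & y \notin compelled T].

Lemma free_edgeC (V : finType) (T : digraph V) : symmetric (free_edge T).
Proof. by move=> x y; rewrite /free_edge adjacentC (andbC (x \notin _)). Qed.

Lemma free_path (V : finType) (T D : digraph V) (s : V) (p : seq V) :
  directed_tree T -> D \in markov_class T -> source D s ->
  uniq (s :: p) -> path (free_edge T) s p -> path (arc D) s p.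
Proof.
move=> treeT DT srcs up fp; apply: source_path_directed => //.
  move=> y x z yp; apply: (free_parent_uniq treeT DT).
  elim: p s fp yp {up srcs} => // a p IHp s /= /andP[/and3P[_ _ Aa] ap].
  by rewrite inE => /predU1P[->//|]; apply: IHp ap.
have /in_markov_class[// |adjD _ _] := DT.
by apply: sub_path fp => x y /and3P[]; rewrite adjD.
Qed.

(** A path between two sources is directed away from the first one, so its last
arc would enter the second one. *)
Lemma free_source_uniq (V : finType) (T D : digraph V) (s s' : V) :
  directed_tree T -> D \in markov_class T -> source D s -> source D s' ->
  connect (free_edge T) s s' -> s = s'.
Proof.
move=> treeT DT srcs /sourceP srcs' /connectP[p0 p0s s'E]; move: srcs'.
rewrite {}s'E; case/shortenP: p0s => p sp up _ {p0}.
have := free_path treeT DT srcs up sp.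
case/lastP: p {sp up} => // p y; rewrite rcons_path last_rcons => /andP[_ py].
by move/(_ (last s p)); rewrite py.
Qed.

(** Within a component of the free part the position of the source determines
the orientation: in both D and D' the tree path from s to y is directed, and its
last arc is the only arc into y. *)
Lemma free_arc_det (V : finType) (T D D' : digraph V) (s x y : V) :
  directed_tree T -> D \in markov_class T -> D' \in markov_class T ->
  source D s -> source D' s -> connect (free_edge T) s y ->
  y \notin compelled T -> arc D x y -> arc D' x y.
Proof.
move=> treeT DT DT' srcs srcs' /connectP[p0 p0s ->].
case/shortenP: p0s => p sp up _ {p0}.
have := free_path treeT DT' srcs' up sp; have := free_path treeT DT srcs up sp.
case/lastP: p {sp up} => [_ _ _|p z]; first by rewrite (negPf (sourceP srcs x)).
rewrite !rcons_path last_rcons => /andP[_ pz] /andP[_ pz'] Az xz.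
by rewrite (free_parent_uniq treeT DT Az xz pz).
Qed.

(** Climbing from child to parent never leaves the free part and ends, by
acyclicity, at a source. *)
Lemma exists_free_source (V : finType) (T D : digraph V) (y : V) :
  directed_tree T -> D \in markov_class T -> y \notin compelled T ->
  exists2 s, source D s & connect (free_edge T) s y.
Proof.
move=> treeT DT; move: y; apply: (dag_ind (markov_class_dag DT)) => y IHy Ay.
have [srcy|] := boolP (source D y); first by exists y; rewrite ?connect0.
rewrite negb_forall => /existsP[x /negPn xy].
have Ax := free_parent treeT DT Ay xy.
have [s srcs sx] := IHy x xy Ax; exists s => //.
apply: connect_trans sx (connect1 _); rewrite /free_edge Ax Ay andbT.
have /in_markov_class[// |adjD _ _] := DT.
by rewrite -adjD /adjacent xy.
Qed.

(** * Reversing arcs and the essential graph *)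

Definition flip (V : finType) (D F : digraph V) : digraph V :=
  [set e | (e \in D) && (e \notin F) || ((e.2, e.1) \in F)].

(** The arcs of F leave sources, are the only arcs into their heads, and no two
of them share a tail; so they have disjoint supports and can be reversed
simultaneously without creating or destroying a collider. *)
Definition flippable (V : finType) (D F : digraph V) : Prop :=
  forall r c, (r, c) \in F ->
    [/\ arc D r c, source D r, forall x, arc D x c -> x = r
      & forall c', (r, c') \in F -> c' = c].

Lemma arc_flip (V : finType) (D F : digraph V) (x y : V) :
  arc (flip D F) x y = arc D x y && ((x, y) \notin F) || ((y, x) \in F).
Proof. by rewrite /arc inE. Qed.

(** A reversed arc c -> r enters the former source r, of which it becomes the only
parent, and c loses its only parent: no pair of arcs meeting head to head
involves a reversed arc, before or after. *)
Lemma flip_markov (V : finType) (T F : digraph V) :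
  directed_tree T -> flippable T F -> flip T F \in markov_class T.
Proof.
move=> treeT flipF; have asymT x y := @dag_asym V T x y treeT.1.
have sub x y : (x, y) \in F -> arc T x y by case/flipF.
apply/in_markov_class => //; split=> [x y|x y|i j k ik].
- rewrite /adjacent !arc_flip.
  have [/sub->|_] := boolP ((x, y) \in F);
  have [/sub->|_] := boolP ((y, x) \in F);
  by rewrite ?andbF ?andbT ?orbT ?orbF.
- rewrite !arc_flip => /orP[/andP[xy nF]|yx].
    by rewrite (negPf nF) orbF (negPf (asymT _ _ xy)).
  rewrite yx andbF /=; apply/negP => /sub.
  by apply/negP; apply/asymT/sub.
rewrite !arc_flip; apply/idP/idP.
  case/andP => /orP[/andP[ij nij]|ji] /orP[/andP[kj nkj]|jk].
  - by rewrite ij kj.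
  - by case: (flipF _ _ jk) => _ /sourceP/(_ i); rewrite ij.
  - by case: (flipF _ _ ji) => _ /sourceP/(_ k); rewrite kj.
  by case: (flipF _ _ ji) ik => _ _ _ /(_ _ jk) ->; rewrite eqxx.
case/andP=> ij kj; rewrite ij kj /=.
have -> /= : (i, j) \notin F.
  by apply/negP => /flipF[_ _ /(_ _ kj) ki]; rewrite ki eqxx in ik.
have -> // : (k, j) \notin F.
by apply/negP => /flipF[_ _ /(_ _ ij) ki]; rewrite ki eqxx in ik.
Qed.

(** To move the source to s, first move it to the parent z of s; then z -> s is the
only arc into s and leaves a source, and reversing it makes s a source. *)
Lemma free_reroot (V : finType) (T : digraph V) (s : V) :
  directed_tree T -> s \notin compelled T ->
  exists2 D, D \in markov_class T & source D s.
Proof.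
move=> treeT; have TT := markov_class_refl treeT.
move: s; apply: (dag_ind treeT.1) => s IHs As.
have [srcs|] := boolP (source T s); first by exists T.
rewrite negb_forall => /existsP[z /negPn zs].
have [D DT srcz] := IHs z zs (free_parent treeT TT As zs).
have treeD := markov_class_tree treeT DT.
have /in_markov_class[// |adjD asymD _] := DT.
have Dzs : arc D z s.
  have : adjacent D z s by rewrite adjD /adjacent zs.
  by case/orP => //; rewrite (negPf (sourceP srcz s)).
exists (flip D [set (z, s)]).
  rewrite -(markov_class_eq DT); apply: flip_markov => // r c.
  rewrite inE => /eqP[-> ->]; split=> // [x xs|c'].
    exact: free_parent_uniq treeT DT As xs Dzs.
  by rewrite inE => /eqP[].
apply/sourceP => x; rewrite arc_flip !inE; apply/negP => /orP[/andP[xs]|].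
  by rewrite (free_parent_uniq treeT DT As xs Dzs) eqxx.
by case/eqP => sz _; move: Dzs (asymD _ _ Dzs); rewrite sz => ->.
Qed.

(** An arc x -> y with y uncompelled is not essential: it is reversed in a member
of the class in which y is a source. *)
Lemma essential_directedE (V : finType) (T : digraph V) :
  directed_tree T ->
  essential_directed T = [set e in T | e.2 \in compelled T].
Proof.
move=> treeT; apply/setP => -[x y]; rewrite [LHS]inE [RHS]inE /=.
case Txy: ((x, y) \in T) => //=; apply/forallP/idP => [ess|Ay D].
  apply/negPn/negP => /(free_reroot treeT)[D DT /sourceP/(_ x)].
  by move/implyP/(_ DT): (ess D); rewrite /arc => ->.
apply/implyP => DT; have := compelled_parents x treeT DT Ay.
by rewrite /arc Txy.
Qed.

Lemma essential_undirectedE (V : finType) (T : digraph V) :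
  directed_tree T -> essential_undirected T =2 free_edge T.
Proof.
move=> treeT x y; rewrite /essential_undirected /free_edge.
case: (boolP (adjacent T x y)) => //= axy.
rewrite essential_directedE //.
have := @compelled_arc V T; move: (compelled T) => A cA.
have asym := @dag_asym V T _ _ treeT.1.
have arcE u v : arc [set e in T | e.2 \in A] u v = arc T u v && (v \in A).
  by rewrite /arc inE.
rewrite /adjacent !arcE negb_or !negb_and.
case/orP: axy => e; rewrite e (negPf (asym _ _ e)) /= ?andbT.
  by apply/idP/andP => [Ay|[]//]; split=> //; apply: contra Ay => /cA; apply.
by apply/idP/andP => [Ax|[]//]; split=> //; apply: contra Ax => /cA; apply.
Qed.

(** * Chain components *)

Lemma connect_equivalence (V : finType) (e : rel V) (S : {set V}) :
  symmetric e -> {in S & &, equivalence_rel (connect e)}.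
Proof.
move=> /sym_connect_sym/same_connect eC x y z _ _ _.
by split=> [|xy]; [exact: connect0 | exact: eC].
Qed.

Lemma chain_components_trivIset (V : finType) (T : digraph V) :
  directed_tree T -> trivIset (chain_components T).
Proof.
move=> treeT.
have symU : symmetric (essential_undirected T).
  by move=> x y; rewrite /essential_undirected !(adjacentC _ x).
apply: trivIsetS (partition_trivIset
  (equivalence_partitionP (connect_equivalence (S := setT) symU))).
by apply/subsetP => C; rewrite inE => /andP[].
Qed.

Lemma in_chain_component (V : finType) (T : digraph V) (C : {set V}) (x y : V) :
  directed_tree T -> C \in chain_components T -> x \in C ->
  (y \in C) = connect (free_edge T) x y.
Proof.
move=> treeT; rewrite inE => /andP[/imsetP[z _ ->] _].
rewrite !inE /= !(eq_connect (essential_undirectedE treeT)).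
by move/(same_connect (sym_connect_sym (@free_edgeC V T))) ->.
Qed.

Lemma mem_chain_component (V : finType) (T : digraph V) (x y : V) :
  directed_tree T -> free_edge T x y ->
  exists2 C, C \in chain_components T & x \in C.
Proof.
move=> treeT xy.
pose C := [set z in setT | connect (essential_undirected T) x z].
exists C; last by rewrite !inE connect0.
rewrite inE; apply/andP; split; first by apply/imsetP; exists x.
apply/card_gt1P; exists x, y; split.
- by rewrite !inE connect0.
- by rewrite !inE connect1 // essential_undirectedE.
apply: contraTneq xy => <-.
by rewrite /free_edge adjacent_irrefl //; case: treeT.
Qed.

Lemma chain_component_neighbour (V : finType) (T : digraph V) (C : {set V})
    (x : V) :
  directed_tree T -> C \in chain_components T -> x \in C ->
  exists2 y, y \in C & free_edge T x y.
Proof.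
move=> treeT CC xC.
have [y yC yx] : exists2 y, y \in C & y != x.
  have : 1 < #|C| by move: CC; rewrite inE => /andP[].
  rewrite (cardD1 x) xC ltnS => /card_gt0P[y /andP[yx yC]].
  by exists y.
have := yC; rewrite (in_chain_component _ treeT CC xC) => /connectP[[|a p]] /=.
  by move=> _ yE; rewrite yE eqxx in yx.
case/andP=> xa _ _; exists a => //.
by rewrite (in_chain_component _ treeT CC xC) connect1.
Qed.

Lemma chain_component_free (V : finType) (T : digraph V) (C : {set V}) (x : V) :
  directed_tree T -> C \in chain_components T -> x \in C ->
  x \notin compelled T.
Proof.
move=> treeT CC xC.
by have [y _ /and3P[]] := chain_component_neighbour treeT CC xC.
Qed.

Lemma chain_component_source (V : finType) (T D : digraph V) (C : {set V}) :
  directed_tree T -> D \in markov_class T -> C \in chain_components T ->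
  exists2 s, source D s & s \in C.
Proof.
move=> treeT DT CC.
have [x xC] : exists x, x \in C.
  by apply/card_gt0P; apply: ltnW; move: CC; rewrite inE => /andP[].
have Ax := chain_component_free treeT CC xC.
have [s srcs sx] := exists_free_source treeT DT Ax; exists s => //.
rewrite (in_chain_component _ treeT CC xC) sym_connect_sym //.
exact: free_edgeC.
Qed.

(** * Counting *)

(** For every set S of chain components, reverse in each of them one arc of T
leaving its source; S is read off from the result. *)
Lemma leq_card_markov_class (V : finType) (T : digraph V) :
  directed_tree T -> 2 ^ #|chain_components T| <= #|markov_class T|.
Proof.
move=> treeT; have TT := markov_class_refl treeT.
have [_ [/card_gt0P[v0 _] _ _]] := treeT.
have root_arc C : exists e : V * V, C \in chain_components T ->
    [/\ e.1 \in C, e.2 \in C, source T e.1 & arc T e.1 e.2].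
  have [CC|] := boolP (C \in chain_components T); last by exists (v0, v0).
  have [s srcs sC] := chain_component_source treeT TT CC.
  have [y yC /and3P[sy _ _]] := chain_component_neighbour treeT CC sC.
  exists (s, y) => _; split=> //=.
  by case/orP: sy => //; rewrite (negPf (sourceP srcs y)).
have [g gP] := fin_all_exists root_arc.
have g_inj : {in chain_components T &, injective g}.
  move=> C C' CC CC' eg; have [gC _ _ _] := gP C CC.
  have [gC' _ _ _] := gP C' CC'; rewrite -eg in gC'.
  have triv := chain_components_trivIset treeT.
  by rewrite -(def_pblock triv CC gC) (def_pblock triv CC' gC').
rewrite -card_powerset.
rewrite -(card_in_imset (f := fun S : {set {set V}} => flip T (g @: S))).
  apply: subset_leq_card; apply/subsetP => _ /imsetP[S + ->].
  rewrite inE => /subsetP SC; apply: flip_markov => // r c.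
  case/imsetP=> C CS gE; have := gP C (SC _ CS); rewrite -gE /=.
  case=> rC cC srcr rc; split=> // [x|c' /imsetP[C' CS' gE']].
    move=> xc; apply: (free_parent_uniq treeT TT _ xc rc).
    exact: chain_component_free treeT (SC _ CS) cC.
  suff CC' : C = C' by move: gE'; rewrite -CC' -gE => -[].
  have [rC' _ _ _] := gP C' (SC _ CS'); rewrite -gE' /= in rC'.
  have triv := chain_components_trivIset treeT.
  by rewrite -(def_pblock triv (SC _ CS) rC) (def_pblock triv (SC _ CS') rC').
have memS (S : {set {set V}}) C : S \subset chain_components T ->
  C \in chain_components T -> (C \in S) = arc (flip T (g @: S)) (g C).2 (g C).1.
  move=> /subsetP SC CC; have [_ _ srcr _] := gP C CC.
  rewrite arc_flip (negPf (sourceP srcr _)) /= -surjective_pairing.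
  apply/idP/imsetP => [CS|[C' CS' /g_inj->//]]; first by exists C.
  exact: SC.
move=> S S'; rewrite !inE => SC SC' eS; apply/setP => C.
have [CC|nC] := boolP (C \in chain_components T).
  by rewrite (memS S C SC CC) (memS S' C SC' CC) eS.
by rewrite (contraNF (subsetP SC C)) // (contraNF (subsetP SC' C)).
Qed.

(** The map sending D to its source in each chain component is injective, by
[compelled_parents] and [free_arc_det]. *)
Lemma card_markov_class_leq (V : finType) (T : digraph V) :
  directed_tree T ->
  #|markov_class T| <= \prod_(C in chain_components T) #|C|.
Proof.
move=> treeT; have [_ [/card_gt0P[v0 _] _ _]] := treeT.
have -> : \prod_(C in chain_components T) #|C| =
    #|pfamily v0 (mem (chain_components T)) (fun C : {set V} => mem C)|.
  by rewrite card_pfamily foldrE big_image.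
(* Finite functions equal to v0 off the chain components, as pfamily requires. *)
pose root (D : digraph V) : {ffun {set V} -> V} :=
  [ffun C : {set V} => if C \in chain_components T
     then odflt v0 [pick s in C | source D s] else v0].
have rootP D C : D \in markov_class T -> C \in chain_components T ->
    root D C \in C /\ source D (root D C).
  move=> DT CC; rewrite ffunE CC; case: pickP => [s /andP[]//|none].
  have [s srcs sC] := chain_component_source treeT DT CC.
  by have := none s; rewrite sC srcs.
rewrite -(card_in_imset (f := root)).
  apply: subset_leq_card; apply/subsetP => _ /imsetP[D DT ->].
  apply/pfamilyP; split=> [|C CC]; last by have [] := rootP D C DT CC.
  by apply/subsetP => C; rewrite inE ffunE; case: ifP => //; rewrite eqxx.
have arc_sub D D' x y : D \in markov_class T -> D' \in markov_class T ->
    root D = root D' -> arc D x y -> arc D' x y.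
  move=> DT DT' eroot xy; have [Ay|Ay] := boolP (y \in compelled T).
    by move: xy; rewrite !(compelled_parents x treeT _ Ay).
  have /in_markov_class[// |adjD _ _] := DT.
  have yx : free_edge T y x.
    rewrite /free_edge (free_parent treeT DT Ay xy) Ay.
    by rewrite -adjD /adjacent xy orbT.
  have [C CC yC] := mem_chain_component treeT yx.
  have [rC srcr] := rootP D C DT CC; have [_] := rootP D' C DT' CC.
  rewrite -eroot => srcr'; apply: free_arc_det srcr srcr' _ Ay xy => //.
  by rewrite -(in_chain_component _ treeT CC rC).
move=> D D' DT DT' eroot; apply/setP => -[x y].
by apply/idP/idP; apply: arc_sub.
Qed.

Lemma leq_card_blocks (V : finType) (P : {set {set V}}) (A : {set V}) :
  trivIset P -> (forall B, B \in P -> exists2 x, x \in B & x \in A) ->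
  #|P| <= #|A|.
Proof.
move=> trivP meetA; apply: leq_trans (leq_imset_card (pblock P) A).
apply: subset_leq_card; apply/subsetP => B BP.
have [x xB xA] := meetA B BP; apply/imsetP; exists x => //.
by rewrite (def_pblock trivP BP xB).
Qed.

(** The head of any essential arc is compelled, and every directed component
contains such a head. *)
Lemma card_directed_components_leq (V : finType) (T : digraph V) :
  directed_tree T -> #|directed_components T| <= #|compelled T|.
Proof.
move=> treeT; apply: leq_card_blocks => [|B].
  by apply: partition_trivIset; apply: equivalence_partitionP;
    apply: connect_equivalence; apply: adjacentC.
case/imsetP=> x; rewrite inE => /existsP[y xy] ->.
have [xend yend] : x \in endpoints (essential_directed T) /\
    y \in endpoints (essential_directed T).
  by split; rewrite inE; apply/existsP; [exists y | exists x; rewrite adjacentC].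
move: (xy); rewrite {1}essential_directedE // /adjacent /arc.
rewrite [X in X || _]inE [X in _ || X]inE /= => /orP[] /andP[_ zA].
  by exists y; rewrite // inE yend connect1.
by exists x; rewrite // inE xend connect0.
Qed.

(** The chain components are disjoint sets of uncompelled vertices, and the
compelled vertices are at least as many as the directed components. *)
Lemma sum_chain_components_leq (V : finType) (T : digraph V) :
  directed_tree T ->
  \sum_(C in chain_components T) #|C| + #|directed_components T| <= #|V|.
Proof.
move=> treeT; rewrite (eqP (chain_components_trivIset treeT)).
rewrite -(cardsC (compelled T)).
rewrite addnC; apply: leq_add; first exact: card_directed_components_leq.
apply: subset_leq_card; apply/subsetP => x /bigcupP[C CC xC].
by rewrite inE (chain_component_free treeT CC xC).
Qed.

Local Open Scope ring_scope.

Theorem theorem3p3 (p l m : nat) (V : finType) (T : digraph V)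
    (hp : #|V| = p) (hT : directed_tree T)
    (hl : #|chain_components T| = l) (l_gt0 : (0 < l)%N)
    (hm : #|directed_components T| = m) :
  (2 ^ l <= #|markov_class T|)%N /\
  (#|markov_class T|%:R : rat) <= ((p%:R - m%:R) / l%:R) ^+ l.
Proof.
split; first by rewrite -hl leq_card_markov_class.
apply: (@le_trans _ _ (\prod_(C in chain_components T) #|C|%:R)).
  by rewrite -natr_prod ler_nat card_markov_class_leq.
have AGM := leif_AGM (A := mem (chain_components T))
  (E := fun C : {set V} => #|C|%:R : rat) (fun C _ => ler0n _ _).
apply: le_trans AGM.1 _; rewrite hl.
apply: lerXn2r; rewrite ?nnegrE ?divr_ge0 ?sumr_ge0 ?ler0n //.
  by rewrite subr_ge0 ler_nat -hm -hp (leq_trans _ (sum_chain_components_leq hT))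
    ?leq_addl.
rewrite ler_pM2r ?invr_gt0 ?ltr0n // lerBrDr -natr_sum -natrD ler_nat.
by rewrite -hp -hm sum_chain_components_leq.
Qed.
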